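(* Let $k$ be a field of characteristic zero. Every free $3$-step nilpotent Lie algebra $\mathfrak{g}$ over $k$ on $n$ generators $x_1,\ldots,x_n$ admits a complete LR-structure.
   Context: An LR-structure on a Lie algebra $\mathfrak{g}$ over $k$ is a bilinear product $\mathfrak{g}\times\mathfrak{g}\to\mathfrak{g}$, $(x,y)\mapsto x\cdot y$, satisfying for all $x,y,z\in\mathfrak{g}$: $x\cdot(y\cdot z)=y\cdot(x\cdot z)$, $(x\cdot y)\cdot z=(x\cdot z)\cdot y$, and $[x,y]=x\cdot y-y\cdot x$. It is complete if all left multiplications $L(x)\colon y\mapsto x\cdot y$ are nilpotent. The free $3$-step nilpotent Lie algebra on $n$ generators is the quotient of the free Lie algebra on $n$ generators by the fourth term $\gamma_4$ of its lower central series (with $\gamma_1$ the whole algebra and $\gamma_{i+1}=[\gamma_1,\gamma_i]$). *)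

(* Defs.v *)
From HB Require Import structures.
From mathcomp Require Import all_boot all_algebra.
Set Implicit Arguments.
Unset Strict Implicit.
Unset Printing Implicit Defensive.
Import GRing.Theory.
Local Open Scope ring_scope.

(* The carrier is an arbitrary, possibly infinite-dimensional, module: free Lie
   algebras are infinite-dimensional in general. *)
HB.mixin Record Lmodule_isLieAlgebra (k : fieldType) g of GRing.Lmodule k g := {
  lie : g -> g -> g;
  lie_is_bilinear : bilinear_for *:%R *:%R lie;
  liexx : forall x, lie x x = 0;
  lie_jacobi : forall x y z,
    lie x (lie y z) + lie y (lie z x) + lie z (lie x y) = 0
}.

#[short(type="lieAlgType")]
HB.structure Definition LieAlgebra (k : fieldType) :=
  { g of GRing.Lmodule k g & Lmodule_isLieAlgebra k g }.

HB.instance Definition _ (k : fieldType) (g : lieAlgType k) :=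
  bilinear_isBilinear.Build k g g g *:%R *:%R (@lie k g) lie_is_bilinear.

Definition lie_morphism (k : fieldType) (g h : lieAlgType k)
    (f : {linear g -> h}) : Prop :=
  forall x y, f (lie x y) = lie (f x) (f y).

Inductive lin_span (k : fieldType) (V : lmodType k) (S : V -> Prop) : V -> Prop :=
| lin_span0 : lin_span S 0
| lin_spanZD a s v : S s -> lin_span S v -> lin_span S (a *: s + v).

Definition lie_span (k : fieldType) (g : lieAlgType k) (A B : g -> Prop) :
    g -> Prop :=
  lin_span (fun z => exists x y, [/\ A x, B y & z = lie x y]).

(* The lower central series is numbered from 1, as in the literature:
   [lower_central g 1] is all of g.  The value at index 0 is a junk value. *)
Fixpoint lower_central (k : fieldType) (g : lieAlgType k) (i : nat) :
    g -> Prop :=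
  match i with
  | 0%N => fun _ => True
  | j.+1 =>
    match j with
    | 0%N => fun _ => True
    | _.+1 => lie_span (fun _ => True) (lower_central (g := g) j)
    end
  end.

(* Universal property of the free Lie algebra on x_1, ..., x_n: every map from
   the generators to a Lie algebra L extends uniquely to a Lie morphism. *)
Definition is_free_lie (k : fieldType) (n : nat) (F : lieAlgType k)
    (x : 'I_n -> F) : Prop :=
  forall (L : lieAlgType k) (f : 'I_n -> L),
    exists phi : {linear F -> L},
      [/\ lie_morphism phi,
          forall i, phi (x i) = f i
        & forall psi : {linear F -> L}, lie_morphism psi ->
            (forall i, psi (x i) = f i) -> psi =1 phi].

(* [pi] exhibits g as the quotient of F by the ideal I. *)
Definition is_lie_quotient (k : fieldType) (F g : lieAlgType k)
    (I : F -> Prop) (pi : {linear F -> g}) : Prop :=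
  [/\ lie_morphism pi,
      forall y, exists z, pi z = y
    & forall z, pi z = 0 <-> I z].

(* g is the quotient of a free Lie algebra F on n generators by gamma_(c+1)(F),
   and x lists the images of the generators. *)
Definition is_free_nilpotent (c : nat) (k : fieldType) (n : nat)
    (g : lieAlgType k) (x : 'I_n -> g) : Prop :=
  exists (F : lieAlgType k) (xF : 'I_n -> F) (pi : {linear F -> g}),
    [/\ is_free_lie xF,
        is_lie_quotient (lower_central (g := F) c.+1) pi
      & forall i, x i = pi (xF i)].

Definition is_LR_structure (k : fieldType) (g : lieAlgType k)
    (mul : {bilinear g -> g -> g}) : Prop :=
  [/\ forall x y z, mul x (mul y z) = mul y (mul x z),
      forall x y z, mul (mul x y) z = mul (mul x z) y
    & forall x y, lie x y = mul x y - mul y x].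

Definition is_complete (k : fieldType) (g : lieAlgType k)
    (mul : {bilinear g -> g -> g}) : Prop :=
  forall x, exists m : nat, forall y, iter m (mul x) y = 0.

(* Main.v *)
Require Import Defs.
From HB Require Import structures.
From mathcomp Require Import all_boot all_algebra.
Set Implicit Arguments.
Unset Strict Implicit.
Unset Printing Implicit Defensive.
Import GRing.Theory.
Local Open Scope ring_scope.

(** The product is written down on the standard generating family
    [x_i], [x_j, x_l] with [j < l], and [z_ijl = [x_i, [x_j, x_l]]] of [g]:
    - [x_i . x_j = [x_i, x_j]] if [i < j], and [0] otherwise;
    - for [j < l], [x_i . [x_j, x_l] = z_pql] with [p = min(i, j)] and
      [q = max(i, j)] if [i < l], and [0] otherwise;
    - for [j < l], [[x_j, x_l] . x_i = - z_pjq] with [p = max(i, l)] and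
      [q = min(i, l)] if [j < i], and [0] otherwise;
    - all products of total degree at least [4] vanish.
    On three generators, [x_i . (x_j . x_l)] vanishes unless both [i] and [j] are
    smaller than [l], and is then visibly symmetric in [i] and [j]; likewise
    [(x_j . x_l) . x_i] vanishes unless [j] is smaller than [i] and [l], and is
    then symmetric in [i] and [l].  This gives both LR identities, because every
    other triple product has degree at least [4].  The identity
    [x . y - y . x = [x, y]] is immediate in degree [2], and in degree [3] it is
    the Jacobi identity for [j < i < l] and immediate for the other positions of
    [i] ([lr_left_right]).  Left multiplications raise the degree, so they are
    nilpotent.

    The product of two elements only depends on their components of degree [1]
    and [2], so a basis of the degree [3] part of [g] is never required.  What has
    to be extracted from the universal property is the following.
    - The components are well defined: there are linear maps
      [A : g -> k^n] and [B : g -> M_n(k)], with [B] skew on brackets, reading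
      off the coordinates.  They are the two components of the morphism from [g]
      to an explicit two-step nilpotent Lie algebra on [k^n * M_n(k)]
      ([free_3_nilpotent_coordinates]).
    - Every [z] differs from its part of degree at most [2],
      [leading_part z = \sum_i A_i x_i + \sum_(i < j) B_ij [x_i, x_j]], by
      a central element ([lie_leading_part]), so that brackets too are functions
      of the coordinates.  Instead of showing that the generators span, one
      checks that, for fixed [w], both [z |-> [z, w]] and
      [z |-> [leading_part z, w]] are derivations with the same values on the
      generators; such derivations coincide because derivations
      [g -> g] are the same as lifts of the identity to Lie morphisms from [g]
      to the dual numbers [g + g e], [e^2 = 0]
      ([free_nilpotent_derivation_ext]). *)

(** * Linear spans, brackets and the lower central series *)

Section LinSpan.
Variables (k : fieldType) (V : lmodType k) (S : V -> Prop).
Implicit Types u v s : V.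

Lemma lin_span_closed (P : V -> Prop) :
    P 0 -> (forall a s v, S s -> P v -> P (a *: s + v)) ->
  forall v, lin_span S v -> P v.
Proof. by move=> P0 PD v; elim=> // a s w Ss _ Pw; apply: PD. Qed.

Lemma lin_span_gen s : S s -> lin_span S s.
Proof.
by move=> Ss; rewrite -[s]addr0 -[s]scale1r; apply: lin_spanZD => //; apply: lin_span0.
Qed.

Lemma lin_spanD u v : lin_span S u -> lin_span S v -> lin_span S (u + v).
Proof.
by move=> + Sv; elim=> [|a s w Ss _ IH]; rewrite ?add0r // -addrA; apply: lin_spanZD.
Qed.

Lemma lin_spanZ a v : lin_span S v -> lin_span S (a *: v).
Proof.
elim=> [|b s w Ss _ IH]; first by rewrite scaler0; apply: lin_span0.
by rewrite scalerDr scalerA; apply: lin_spanZD.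
Qed.

End LinSpan.

Section LieBasics.
Variables (k : fieldType) (g : lieAlgType k).
Implicit Types x y z u v w : g.

Lemma lieC x y : lie x y = - lie y x.
Proof.
apply/eqP; rewrite -addr_eq0; apply/eqP.
by have := liexx (x + y); rewrite linearDl !linearDr /= !liexx add0r addr0.
Qed.

Lemma lie_leibniz x y z : lie x (lie y z) = lie (lie x y) z + lie y (lie x z).
Proof.
apply/eqP; rewrite -subr_eq0; apply/eqP; rewrite -[RHS](lie_jacobi x y z).
by rewrite opprD -[lie x z]opprK -lieC linearNr opprK -lieC addrAC addrA.
Qed.

Lemma lie_leibnizl x y z : lie (lie x y) z = lie x (lie y z) - lie y (lie x z).
Proof. by rewrite lie_leibniz addrK. Qed.

Lemma lower_central_lie i x y :
  lower_central i.+1 y -> lower_central i.+2 (lie x y).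
Proof. by move=> ly; apply: lin_span_gen; exists x, y. Qed.

End LieBasics.

Lemma lie_morphism_lower_central (k : fieldType) (g h : lieAlgType k)
    (phi : {linear g -> h}) : lie_morphism phi ->
  forall i z, lower_central i z -> lower_central i (phi z).
Proof.
move=> phiM; case=> [|i] //; elim: i => // i IHi z.
apply: (@lin_span_closed _ _ _ (fun z => lower_central i.+2 (phi z)))
  => [|a s v [y [w [_ lw ->]]] IHv].
  by rewrite linear0; apply: lin_span0.
rewrite linearP phiM; apply: lin_spanZD IHv.
by exists (phi y), (phi w); split=> //; apply: IHi.
Qed.

(** * The universal property of free nilpotent Lie algebras *)

Section FreeNilpotent.
Variables (k : fieldType) (c n : nat) (g : lieAlgType k) (x : 'I_n -> g).
Hypothesis free_x : is_free_nilpotent c x.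

(** Surjectivity of the projection from the free Lie algebra passes to each term
    of the lower central series. *)
Lemma free_nilpotent_nilpotent (z : g) : lower_central c.+1 z -> z = 0.
Proof.
have [F [xF [pi [_ [piM piS kerpi] _]]]] := free_x.
have lift : forall i (y : g), lower_central i y ->
    exists2 w : F, lower_central i w & pi w = y.
  case=> [|i] y; first by have [w] := piS y; exists w.
  elim: i y => [|i IHi] y; first by have [w] := piS y; exists w.
  apply: (@lin_span_closed _ _ _
    (fun y => exists2 w : F, lower_central i.+2 w & pi w = y))
    => [|a s v [p [q [_ lq ->]]] [w lw <-]].
    by exists 0; [apply: lin_span0 | rewrite linear0].
  have [q' lq' <-] := IHi _ lq; have [p' <-] := piS p.
  exists (a *: lie p' q' + w); last by rewrite linearP piM.
  by apply: lin_spanZD lw; exists p', q'.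
by move=> /lift[w /kerpi pw0 <-].
Qed.

Lemma free_nilpotent_ext (L : lieAlgType k) (psi1 psi2 : {linear g -> L}) :
    lie_morphism psi1 -> lie_morphism psi2 ->
    (forall i, psi1 (x i) = psi2 (x i)) ->
  psi1 =1 psi2.
Proof.
have [F [xF [pi [freeF [piM piS _] xE]]]] := free_x.
move=> M1 M2 eq12 y; have [z <-] := piS y.
have [phi [_ _ phi_uniq]] := freeF L (psi1 \o x).
have e1 : (psi1 \o pi : {linear F -> L}) =1 phi.
  by apply: phi_uniq => [u v|i] /=; rewrite ?piM ?M1 ?xE.
have e2 : (psi2 \o pi : {linear F -> L}) =1 phi.
  by apply: phi_uniq => [u v|i] /=; rewrite ?piM ?M2 -?xE -?eq12.
by rewrite -[LHS]/((psi1 \o pi) z) e1 -e2.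
Qed.

(** A morphism from the free Lie algebra to a nilpotent algebra of class [c]
    vanishes on [gamma_(c+1)], hence can be computed on any preimage. *)
Lemma free_nilpotent_lift (L : lieAlgType k) (f : 'I_n -> L) :
    (forall z : L, lower_central c.+1 z -> z = 0) ->
  exists phi : {linear g -> L}, lie_morphism phi /\ forall i, phi (x i) = f i.
Proof.
move=> nilL; have [F [xF [pi [freeF [piM piS kerpi] xE]]]] := free_x.
have [phi [phiM phix _]] := freeF L f.
(* As [g] has a choice operator, a preimage can be chosen once equality is
     expressed as a boolean. *)
have piS' y : exists z, pi z == y by have [z <-] := piS y; exists z.
pose s y := xchoose (piS' y).
have sK y : pi (s y) = y by apply/eqP/(xchooseP (piS' y)).
have phi_pi z w : pi z = pi w -> phi z = phi w.
  move=> pzw; apply/eqP; rewrite -subr_eq0 -linearB; apply/eqP/nilL.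
  by apply: lie_morphism_lower_central => //; apply/kerpi; rewrite linearB pzw subrr.
have lin : linear (phi \o s).
  by move=> a u v /=; rewrite -linearP; apply: phi_pi; rewrite linearP !sK.
pose phi' : {linear g -> L} :=
  HB.pack (phi \o s) (GRing.isLinear.Build k g L *:%R (phi \o s) lin).
exists phi'; split=> [u v|i] /=.
  by rewrite -phiM; apply: phi_pi; rewrite piM !sK.
by rewrite -phix; apply: phi_pi; rewrite sK xE.
Qed.

End FreeNilpotent.

(** * Derivations as morphisms to dual numbers *)

(** The Lie algebra [g + g e] with [e^2 = 0], on pairs; the alias keeps its bracket
    apart from other structures on [g * g]. *)
Definition dual_number_lie (k : fieldType) (g : lieAlgType k) : Type :=
  (g * g)%type.

Section DualNumbers.
Variables (k : fieldType) (g : lieAlgType k).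

HB.instance Definition _ := GRing.Lmodule.on (dual_number_lie g).

Definition dual_bracket (p q : dual_number_lie g) : dual_number_lie g :=
  (lie p.1 q.1, lie p.1 q.2 + lie p.2 q.1).

Lemma dual_bracket_bilinear : bilinear_for *:%R *:%R dual_bracket.
Proof.
split=> p a q r; congr pair => /=.
- by rewrite linearPl.
- by rewrite !linearPl scalerDr addrACA.
- by rewrite linearPr.
- by rewrite !linearPr scalerDr addrACA.
Qed.

Lemma dual_bracketxx p : dual_bracket p p = 0.
Proof. by rewrite /dual_bracket liexx [lie p.1 _]lieC addNr. Qed.

Lemma dual_bracket_jacobi p q r :
  dual_bracket p (dual_bracket q r) + dual_bracket q (dual_bracket r p)
    + dual_bracket r (dual_bracket p q) = 0.
Proof.
congr pair => /=; first exact: lie_jacobi.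
rewrite !linearDr /=.
by rewrite (AC (3*3*3) ((1*5*9)*(2*6*7)*(3*4*8))) /= !lie_jacobi !addr0.
Qed.

HB.instance Definition _ := Lmodule_isLieAlgebra.Build k (dual_number_lie g)
  dual_bracket_bilinear dual_bracketxx dual_bracket_jacobi.

End DualNumbers.

Definition is_derivation (k : fieldType) (g : lieAlgType k) (d : g -> g) : Prop :=
  forall x y, d (lie x y) = lie x (d y) + lie (d x) y.

(** [d] is a derivation if and only if [z |-> z + d z e] is a Lie morphism to the
    dual numbers, so uniqueness of morphisms gives uniqueness of derivations. *)
Lemma free_nilpotent_derivation_ext (k : fieldType) (c n : nat)
    (g : lieAlgType k) (x : 'I_n -> g) (d1 d2 : g -> g) :
    is_free_nilpotent c x ->
    linear d1 -> is_derivation d1 -> linear d2 -> is_derivation d2 ->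
    (forall i, d1 (x i) = d2 (x i)) ->
  d1 =1 d2.
Proof.
move=> free_x lin1 der1 lin2 der2 eq12 z.
have graph d : linear d -> is_derivation d ->
    exists2 psi : {linear g -> dual_number_lie g},
      lie_morphism psi & forall y, psi y = (y, d y).
  move=> dlin dder; pose psi y : dual_number_lie g := (y, d y).
  have lin : linear psi by move=> a u v; rewrite /psi dlin.
  exists (HB.pack_for {linear g -> dual_number_lie g} psi
    (GRing.isLinear.Build k g _ *:%R psi lin)) => // u v /=.
  by rewrite /psi dder.
have [psi1 M1 E1] := graph d1 lin1 der1; have [psi2 M2 E2] := graph d2 lin2 der2.
suff: psi1 z = psi2 z by rewrite E1 E2; case.
by apply: (free_nilpotent_ext free_x) => // i; rewrite E1 E2 eq12.
Qed.

(** * Coordinates of degree one and two *)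

(** A model large enough to see the free two-step nilpotent quotient: the bracket
    of two vectors is their exterior product, as a skew matrix. *)
Definition two_step_lie (k : fieldType) (n : nat) : Type :=
  ('rV[k]_n * 'M[k]_n)%type.

Section TwoStep.
Variables (k : fieldType) (n : nat).

HB.instance Definition _ := GRing.Lmodule.on (two_step_lie k n).

Definition two_step_bracket (p q : two_step_lie k n) : two_step_lie k n :=
  (0, p.1^T *m q.1 - q.1^T *m p.1).

Lemma two_step_bracket_bilinear : bilinear_for *:%R *:%R two_step_bracket.
Proof.
have trP a (u v : 'rV[k]_n) : (a *: u + v)^T = a *: u^T + v^T by rewrite linearP.
by split=> p a q r; congr pair => /=; rewrite ?scaler0 ?addr0 // trP mulmxDl mulmxDr
  -scalemxAl -scalemxAr scalerBr opprD addrACA.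
Qed.

Lemma two_step_bracketxx p : two_step_bracket p p = 0.
Proof. by rewrite /two_step_bracket subrr. Qed.

Lemma two_step_bracket0 p q : q.1 = 0 -> two_step_bracket p q = 0.
Proof. by rewrite /two_step_bracket => ->; rewrite trmx0 mulmx0 mul0mx subrr. Qed.

Lemma two_step_bracket_jacobi p q r :
  two_step_bracket p (two_step_bracket q r)
    + two_step_bracket q (two_step_bracket r p)
    + two_step_bracket r (two_step_bracket p q) = 0.
Proof.
by do 3![rewrite (@two_step_bracket0 _ (two_step_bracket _ _)) //]; rewrite !addr0.
Qed.

HB.instance Definition _ := Lmodule_isLieAlgebra.Build k (two_step_lie k n)
  two_step_bracket_bilinear two_step_bracketxx two_step_bracket_jacobi.

Lemma two_step_nilpotent (z : two_step_lie k n) : lower_central 4 z -> z = 0.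
Proof.
have l2 (q : two_step_lie k n) : lower_central 2 q -> q.1 = 0.
  apply: (@lin_span_closed _ _ _ (fun q => q.1 = 0)) => [//|a s v].
  by move=> [? [? [_ _ ->]]] /= ->; rewrite scaler0 addr0.
have l3 (q : two_step_lie k n) : lower_central 3 q -> q = 0.
  apply: (@lin_span_closed _ _ _ (fun q => q = 0)) => [//|a s v].
  by move=> [y [w [_ lw ->]]] ->; rewrite addr0 [lie _ _]two_step_bracket0 ?scaler0 ?l2.
apply: (@lin_span_closed _ _ _ (fun q => q = 0)) => [//|a s v].
by move=> [y [w [_ /l3-> ->]]] ->; rewrite linear0r scaler0 addr0.
Qed.

End TwoStep.

Lemma free_3_nilpotent_coordinates (k : fieldType) (n : nat) (g : lieAlgType k)
    (x : 'I_n -> g) : is_free_nilpotent 3 x ->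
  exists (A : {linear g -> 'rV[k]_n}) (B : {linear g -> 'M[k]_n}),
    [/\ forall u v, A (lie u v) = 0,
        forall u v, B (lie u v) = (A u)^T *m A v - (A v)^T *m A u,
        forall i, A (x i) = delta_mx 0 i
      & forall i, B (x i) = 0].
Proof.
move=> free_x.
pose f i : two_step_lie k n := (delta_mx 0 i, 0).
have [phi [phiM phix]] := free_nilpotent_lift free_x f (@two_step_nilpotent k n).
have linA : linear (fun u => (phi u).1) by move=> c u v; rewrite linearP.
have linB : linear (fun u => (phi u).2) by move=> c u v; rewrite linearP.
exists (HB.pack_for {linear g -> 'rV[k]_n} (fun u => (phi u).1)
  (GRing.isLinear.Build k g _ *:%R (fun u => (phi u).1) linA)).
exists (HB.pack_for {linear g -> 'M[k]_n} (fun u => (phi u).2)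
  (GRing.isLinear.Build k g _ *:%R (fun u => (phi u).2) linB)).
by split=> [u v|u v|i|i] /=; rewrite ?phiM ?phix.
Qed.

(** * Linear combinations of indexed families *)

Section LinearCombinations.
Variables (k : fieldType) (n : nat).

Section Module.
Variable V : lmodType k.

Definition comb1 (f : 'I_n -> V) (a : 'rV[k]_n) : V := \sum_i a 0 i *: f i.

Definition comb2 (f : 'I_n -> 'I_n -> V) (M : 'M[k]_n) : V :=
  \sum_i \sum_j M i j *: f i j.

Definition comb3 (f : 'I_n -> 'I_n -> 'I_n -> V) (a : 'rV[k]_n) (M : 'M[k]_n) : V :=
  comb1 (fun i => comb2 (f i) M) a.

Lemma comb1_linear f : linear (comb1 f).
Proof.
move=> c a b; rewrite /comb1 scaler_sumr -big_split /=; apply: eq_bigr => i _.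
by rewrite !mxE scalerDl scalerA.
Qed.
HB.instance Definition _ f :=
  GRing.isLinear.Build k 'rV[k]_n V *:%R (comb1 f) (comb1_linear f).

Lemma comb2_linear f : linear (comb2 f).
Proof.
move=> c a b; rewrite /comb2 scaler_sumr -big_split /=; apply: eq_bigr => i _.
rewrite scaler_sumr -big_split /=; apply: eq_bigr => j _.
by rewrite !mxE scalerDl scalerA.
Qed.
HB.instance Definition _ f :=
  GRing.isLinear.Build k 'M[k]_n V *:%R (comb2 f) (comb2_linear f).

Lemma comb3_bilinear f : bilinear_for *:%R *:%R (comb3 f).
Proof.
split=> [M|a] c u v; rewrite /comb3; first by rewrite linearP.
rewrite /comb1 /= scaler_sumr -big_split /=; apply: eq_bigr => i _.
by rewrite linearP scalerDr !scalerA mulrC.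
Qed.
HB.instance Definition _ f :=
  bilinear_isBilinear.Build k 'rV[k]_n 'M[k]_n V *:%R *:%R (comb3 f)
    (comb3_bilinear f).

Lemma eq_comb2 f1 f2 (M1 M2 : 'M[k]_n) :
    (forall i j, M1 i j *: f1 i j = M2 i j *: f2 i j) ->
  comb2 f1 M1 = comb2 f2 M2.
Proof. by move=> e; apply: eq_bigr => i _; apply: eq_bigr => j _. Qed.

Lemma eq_comb3 f1 f2 a (M1 M2 : 'M[k]_n) :
    (forall i j l, M1 j l *: f1 i j l = M2 j l *: f2 i j l) ->
  comb3 f1 a M1 = comb3 f2 a M2.
Proof. by move=> e; apply: eq_bigr => i _; congr (_ *: _); apply: eq_comb2. Qed.

Lemma comb3B f1 f2 a M :
  comb3 (fun i j l => f1 i j l - f2 i j l) a M = comb3 f1 a M - comb3 f2 a M.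
Proof.
rewrite /comb3 /comb1 -sumrB; apply: eq_bigr => i _.
rewrite -scalerBr; congr (_ *: _); rewrite /comb2 -sumrB; apply: eq_bigr => j _.
by rewrite -sumrB; apply: eq_bigr => l _; rewrite scalerBr.
Qed.

Lemma comb3_outer f a (b c : 'rV[k]_n) :
  comb3 f a (b^T *m c) =
  \sum_i \sum_j \sum_l (a 0 i * (b 0 j * c 0 l)) *: f i j l.
Proof.
apply: eq_bigr => i _; rewrite /comb2 scaler_sumr; apply: eq_bigr => j _.
rewrite scaler_sumr; apply: eq_bigr => l _.
by rewrite scalerA mxE big_ord1 mxE.
Qed.

End Module.

Lemma linear_comb1 (V W : lmodType k) (h : {linear V -> W}) f a :
  h (comb1 f a) = comb1 (h \o f) a.
Proof. by rewrite linear_sum; apply: eq_bigr => i _; rewrite linearZ. Qed.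

Lemma linear_comb2 (V W : lmodType k) (h : {linear V -> W}) f M :
  h (comb2 f M) = comb2 (fun i j => h (f i j)) M.
Proof.
rewrite linear_sum; apply: eq_bigr => i _; rewrite linear_sum.
by apply: eq_bigr => j _; rewrite linearZ.
Qed.

Lemma linear_comb3 (V W : lmodType k) (h : {linear V -> W}) f a M :
  h (comb3 f a M) = comb3 (fun i j l => h (f i j l)) a M.
Proof.
rewrite linear_comb1; apply: eq_bigr => i _.
by rewrite /= linear_comb2.
Qed.

Lemma comb2_0 (V : lmodType k) (f : 'I_n -> 'I_n -> V) M :
  (forall i j, f i j = 0) -> comb2 f M = 0.
Proof.
move=> f0; rewrite /comb2 !big1 // => i _; rewrite big1 // => j _.
by rewrite f0 scaler0.
Qed.

Lemma comb3_0 (V : lmodType k) (f : 'I_n -> 'I_n -> 'I_n -> V) a M :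
  (forall i j l, f i j l = 0) -> comb3 f a M = 0.
Proof.
by move=> f0; rewrite /comb3 /comb1 big1 // => i _; rewrite comb2_0 ?scaler0.
Qed.

End LinearCombinations.

(** * The LR-product *)

Section LRProduct.
Variables (k : fieldType) (n : nat) (g : lieAlgType k) (x : 'I_n -> g).
Variables (A : {linear g -> 'rV[k]_n}) (B : {linear g -> 'M[k]_n}).
Hypothesis free_x : is_free_nilpotent 3 x.
Hypothesis A_lie : forall u v, A (lie u v) = 0.
Hypothesis B_lie : forall u v,
  B (lie u v) = (A u)^T *m A v - (A v)^T *m A u.
Hypothesis A_x : forall i, A (x i) = delta_mx 0 i.
Hypothesis B_x : forall i, B (x i) = 0.

Let nil4 u v w z : lie u (lie v (lie w z)) = 0 :> g.
Proof.
by apply: (free_nilpotent_nilpotent free_x); do 3 apply: lower_central_lie.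
Qed.

Definition comm2 (i j : 'I_n) : g := if (i < j)%N then lie (x i) (x j) else 0.

(** Folding the terms [i > j] onto the terms [i < j] turns the full double sum into
    the one over ordered pairs of generators. *)
Lemma comb2_comm2_skew a b :
  comb2 comm2 (a^T *m b - b^T *m a) = lie (comb1 x a) (comb1 x b).
Proof.
have E (c d : 'rV[k]_n) :
    comb2 comm2 (c^T *m d) = \sum_i \sum_j (c 0 i * d 0 j) *: comm2 i j.
  apply: eq_bigr => i _; apply: eq_bigr => j _.
  by rewrite mxE big_ord1 mxE.
rewrite linearB /= !E [X in _ - X]exchange_big -sumrB /=.
rewrite linear_sumlz; apply: eq_bigr => i _.
rewrite -sumrB linear_sumr; apply: eq_bigr => j _.
rewrite linearZr linearZl_LR /= scalerA [b 0 j * _]mulrC -scalerBr; congr (_ *: _).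
rewrite /comm2; case: (ltngtP i j) => [ij|ij|/val_inj ->].
- by rewrite subr0.
- by rewrite sub0r -lieC.
- by rewrite subrr liexx.
Qed.

Definition gen_part u := comb1 x (A u).
Definition leading_part u := gen_part u + comb2 comm2 (B u).

Lemma comb2_lie u v : comb2 comm2 (B (lie u v)) = lie (gen_part u) (gen_part v).
Proof. by rewrite B_lie comb2_comm2_skew. Qed.

Lemma gen_part_linear : linear gen_part.
Proof. by move=> c u v; rewrite /gen_part !linearP. Qed.
HB.instance Definition _ :=
  GRing.isLinear.Build k g g *:%R gen_part gen_part_linear.

Lemma leading_part_linear : linear leading_part.
Proof. by move=> c u v; rewrite /leading_part !linearP scalerDr addrACA. Qed.
HB.instance Definition _ :=
  GRing.isLinear.Build k g g *:%R leading_part leading_part_linear.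

Lemma comb1_delta i : comb1 x (delta_mx 0 i) = x i.
Proof.
rewrite /comb1 (bigD1 i) //= mxE !eqxx scale1r big1 ?addr0 // => j ji.
by rewrite mxE (negbTE ji) scale0r.
Qed.

Lemma gen_part_x i : gen_part (x i) = x i.
Proof. by rewrite /gen_part A_x comb1_delta. Qed.

Lemma leading_part_x i : leading_part (x i) = x i.
Proof. by rewrite /leading_part gen_part_x B_x linear0 addr0. Qed.

Lemma lie_linearl (h : {linear g -> g}) w : linear (fun z => lie (h z) w).
Proof. by move=> c u v; rewrite linearP linearPl. Qed.

Lemma is_derivation_lie w : is_derivation (fun z : g => lie z w).
Proof. by move=> u v; rewrite lie_leibnizl [lie (lie u w) v]lieC. Qed.

(** First approximation of [lie_leading_part]: against an element of [gamma_2], the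
    degree one part suffices.  Both sides are derivations of [z] that kill
    brackets, since [gamma_4 = 0]. *)
Lemma lie_gen_part z u v : lie z (lie u v) = lie (gen_part z) (lie u v).
Proof.
apply: (free_nilpotent_derivation_ext free_x (d1 := fun z => lie z (lie u v))
  (d2 := fun z => lie (gen_part z) (lie u v))) => [|||y w|i].
- exact: (lie_linearl idfun).
- exact: is_derivation_lie.
- exact: lie_linearl.
- rewrite /= [lie (lie (gen_part y) _) w]lieC !nil4 oppr0 addr0.
  by rewrite /gen_part A_lie linear0 linear0l.
- by rewrite gen_part_x.
Qed.

Lemma comb2_comm2_lower_central M : lower_central 2 (comb2 comm2 M).
Proof.
pose S (z : g) := exists u v, [/\ True, True & z = lie u v].
apply: (big_ind (lin_span S)) => [||i _]; [exact: lin_span0|exact: lin_spanD|].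
apply: (big_ind (lin_span S)) => [||j _]; [exact: lin_span0|exact: lin_spanD|].
apply: lin_spanZ; rewrite /comm2; case: ifP => _; last exact: lin_span0.
by apply: lin_span_gen; exists (x i), (x j).
Qed.

Lemma lie_lie_comb2 z v M : lie z (lie v (comb2 comm2 M)) = 0.
Proof.
apply: (free_nilpotent_nilpotent free_x).
by do 2 apply: lower_central_lie; apply: comb2_comm2_lower_central.
Qed.

Lemma lie_comb2_comb2 M N : lie (comb2 comm2 M) (comb2 comm2 N) = 0.
Proof.
apply: (@lin_span_closed _ _ _ (fun u => lie u (comb2 comm2 N) = 0) _ _ _
  (comb2_comm2_lower_central M)) => [|a _ v [u [w [_ _ ->]]] IH].
  by rewrite linear0l.
by rewrite linearPl /= IH lie_leibnizl !lie_lie_comb2 subrr scaler0 addr0.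
Qed.

(** The right-hand side is a derivation of [z]: the leading part of a bracket is the
    bracket of the degree one parts, and [lie_gen_part] replaces those by the
    elements themselves once they are bracketed with an element of [gamma_2]. *)
Lemma lie_leading_part z w : lie z w = lie (leading_part z) w.
Proof.
apply: (free_nilpotent_derivation_ext free_x (d1 := fun z => lie z w)
  (d2 := fun z => lie (leading_part z) w)) => [|||u v|i].
- exact: (lie_linearl idfun).
- exact: is_derivation_lie.
- exact: lie_linearl.
- have lie_lead y z' : lie y (lie (leading_part z') w) = lie y (lie (gen_part z') w).
    rewrite /leading_part linearDl linearDr /= [lie (comb2 _ _) _]lieC.
    by rewrite [lie y (- _)]linearNr /= lie_lie_comb2 oppr0 addr0.
  rewrite {1}/leading_part comb2_lie /gen_part A_lie linear0 add0r -!/(gen_part _).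
  rewrite lie_leibnizl [lie (lie (leading_part u) w) v]lieC !lie_lead.
  by rewrite -!lie_gen_part.
- by rewrite leading_part_x.
Qed.

Lemma lie_comb1_comb2 a M :
  lie (comb1 x a) (comb2 comm2 M)
  = comb3 (fun i j l => lie (x i) (comm2 j l)) a M.
Proof.
rewrite /comb1 linear_sumlz; apply: eq_bigr => i _.
rewrite linearZl_LR /= /comb2 linear_sumr; congr (_ *: _); apply: eq_bigr => j _.
by rewrite linear_sumr; apply: eq_bigr => l _; rewrite linearZr_LR.
Qed.

Lemma lie_coord u v :
  lie u v = comb2 comm2 ((A u)^T *m A v - (A v)^T *m A u)
    + comb3 (fun i j l => lie (x i) (comm2 j l)) (A u) (B v)
    - comb3 (fun i j l => lie (x i) (comm2 j l)) (A v) (B u).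
Proof.
rewrite lie_leading_part lieC lie_leading_part -lieC /leading_part.
rewrite linearDl !linearDr /= lie_comb2_comb2 addr0 comb2_comm2_skew.
by rewrite -!lie_comb1_comb2 [lie (comb2 _ _) _]lieC.
Qed.

(** The product [x_i . [x_j, x_l]] for [j < l]. *)
Definition lr_left (i j l : 'I_n) : g :=
  if (i < l)%N && (j < l)%N then
    (if (i <= j)%N then lie (x i) (lie (x j) (x l))
     else lie (x j) (lie (x i) (x l)))
  else 0.

(** The product [[x_j, x_l] . x_i] for [j < l], with the index of the generator in front so
    that [lr_left] and [lr_right] are combined by the same [comb3]. *)
Definition lr_right (i j l : 'I_n) : g :=
  if (j < l)%N && (j < i)%N then
    - (if (l <= i)%N then lie (x i) (lie (x j) (x l))
       else lie (x l) (lie (x j) (x i)))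
  else 0.

Definition lr_mul u v :=
  comb2 comm2 ((A u)^T *m A v) + comb3 lr_left (A u) (B v)
    + comb3 lr_right (A v) (B u).

Lemma lr_leftC i j l : lr_left i j l = lr_left j i l.
Proof. by rewrite /lr_left andbC; case: (ltngtP i j) => // /ord_inj->. Qed.

Lemma lr_rightC i j l : lr_right i j l = lr_right l j i.
Proof. by rewrite /lr_right andbC; case: (ltngtP l i) => // /ord_inj->. Qed.

(** For [j < l], only one of the two terms survives when [i <= j] or [l <= i]; both
    do when [j < i < l], and the Jacobi identity then combines them. *)
Lemma lr_left_right i j l : lr_left i j l - lr_right i j l = lie (x i) (comm2 j l).
Proof.
rewrite /lr_left /lr_right /comm2 [(j < l)%N && _]andbC.
case: (ltnP j l) => jl; last by rewrite !andbF subrr linear0r.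
rewrite !andbT; case: (leqP i j) => [ij|ji].
  by rewrite (leq_ltn_trans ij jl) subr0.
case: (ltnP i l) => [il|li]; last by rewrite opprK add0r.
rewrite opprK [RHS]lie_leibniz addrC [lie (x l) _]lieC [lie (x j) (x i)]lieC.
by rewrite linearNl opprK.
Qed.

Lemma lr_mul_bilinear : bilinear_for *:%R *:%R lr_mul.
Proof.
have addACA6 (a1 a2 b1 b2 c1 c2 : g) :
    a1 + a2 + (b1 + b2) + (c1 + c2) = a1 + b1 + c1 + (a2 + b2 + c2).
  by rewrite (AC (2*2*2) ((1*3*5)*(2*4*6))).
split=> w c u v; rewrite /lr_mul /= !linearP.
  by rewrite !linearPl !linearPr !linearP /= !scalerDr addACA6.
by rewrite !linearPl !linearPr /= !scalerDr addACA6.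
Qed.


Lemma lr_mul_lie u v : lie u v = lr_mul u v - lr_mul v u.
Proof.
have E a M : comb3 (fun i j l => lie (x i) (comm2 j l)) a M
    = comb3 lr_left a M - comb3 lr_right a M.
  by rewrite -comb3B; apply: eq_comb3 => i j l; rewrite lr_left_right.
rewrite lie_coord !E linearB /= /lr_mul !opprD !opprK.
by rewrite (AC (2*2*2) ((1*3*6)*(2*5*4))).
Qed.

Lemma A_comb2 M : A (comb2 comm2 M) = 0.
Proof.
rewrite linear_comb2 comb2_0 // => i j.
by rewrite /comm2; case: ifP; rewrite ?A_lie ?linear0.
Qed.

Lemma B_lie0 u v w : B (lie u (lie v w)) = 0.
Proof. by rewrite B_lie A_lie trmx0 mul0mx mulmx0 subrr. Qed.

Lemma lr_leftE i j l : exists u v w, lr_left i j l = lie u (lie v w).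
Proof.
rewrite /lr_left; case: ifP => _; last by exists 0, 0, 0; rewrite linear0l.
by case: ifP => _; [exists (x i), (x j), (x l) | exists (x j), (x i), (x l)].
Qed.

Lemma lr_rightE i j l : exists u v w, lr_right i j l = lie u (lie v w).
Proof.
rewrite /lr_right; case: ifP => _; last by exists 0, 0, 0; rewrite linear0l.
by case: ifP => _; rewrite -linearNl; do 3 eexists.
Qed.

Lemma A_lr_mul u v : A (lr_mul u v) = 0.
Proof.
rewrite !linearD /= A_comb2 !linear_comb3 !comb3_0 ?addr0 // => i j l.
  by have [? [? [? ->]]] := lr_rightE i j l; rewrite A_lie.
by have [? [? [? ->]]] := lr_leftE i j l; rewrite A_lie.
Qed.

Lemma B_lr_mul u v : B (lr_mul u v) = B (comb2 comm2 ((A u)^T *m A v)).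
Proof.
rewrite !linearD /= !(linear_comb3 B) !comb3_0 ?addr0 // => i j l.
  by have [? [? [? ->]]] := lr_rightE i j l; rewrite B_lie0.
by have [? [? [? ->]]] := lr_leftE i j l; rewrite B_lie0.
Qed.

Lemma B_comm2 p q (i j : 'I_n) :
  (i < j)%N -> B (comm2 p q) i j = ((p == i) && (q == j))%:R.
Proof.
move=> ij; rewrite /comm2; case: ifP => pq.
  rewrite B_lie !A_x !mxE !big_ord1 !mxE /= -!natrM !mulnb.
  have -> : (i == q) && (j == p) = false.
    by apply/negP => /andP[/eqP iq /eqP jp]; move: pq; rewrite -iq -jp ltnNge ltnW.
  by rewrite subr0 ![_ == p]eq_sym ![_ == q]eq_sym.
rewrite linear0 mxE; case: eqP => [pi|//]; case: eqP => [qj|//].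
by move: pq; rewrite pi qj ij.
Qed.

(** Only entries above the diagonal are recovered; these are the only ones that
    [lr_left] and [lr_right] do not annihilate. *)
Lemma B_comb2 M (i j : 'I_n) : (i < j)%N -> B (comb2 comm2 M) i j = M i j.
Proof.
move=> ij; rewrite linear_comb2 /comb2 summxE (bigD1 i) //= summxE (bigD1 j) //=.
rewrite mxE B_comm2 // !eqxx mulr1 !big1 ?addr0 // => [p pi|q qj].
  by rewrite summxE big1 // => q _; rewrite mxE B_comm2 // (negbTE pi) mulr0.
by rewrite mxE B_comm2 // (negbTE qj) andbF mulr0.
Qed.

Lemma lr_mul_lr_mulr u v w : lr_mul u (lr_mul v w) = comb3 lr_left (A u) ((A v)^T *m A w).
Proof.
rewrite {1}/lr_mul A_lr_mul mulmx0 linear0 linear0l add0r addr0 B_lr_mul.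
apply: eq_comb3 => i j l; rewrite /lr_left.
by case: (ltnP j l) => [jl|]; rewrite ?andbF ?scaler0 // B_comb2.
Qed.

Lemma lr_mul_lr_mull u v w : lr_mul (lr_mul u v) w = comb3 lr_right (A w) ((A u)^T *m A v).
Proof.
rewrite {1}/lr_mul A_lr_mul trmx0 mul0mx linear0 linear0l !add0r B_lr_mul.
apply: eq_comb3 => i j l; rewrite /lr_right.
by case: (ltnP j l) => [jl|]; rewrite ?scaler0 // B_comb2.
Qed.

Lemma lr_mul_leftC u v w : lr_mul u (lr_mul v w) = lr_mul v (lr_mul u w).
Proof.
rewrite !lr_mul_lr_mulr !comb3_outer exchange_big /=.
do 3![apply: eq_bigr => ? _].
by rewrite lr_leftC mulrCA.
Qed.

Lemma lr_mul_rightC u v w : lr_mul (lr_mul u v) w = lr_mul (lr_mul u w) v.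
Proof.
rewrite !lr_mul_lr_mull !comb3_outer exchange_big [RHS]exchange_big /=.
apply: eq_bigr => j _; rewrite exchange_big /=.
do 2![apply: eq_bigr => ? _].
by rewrite lr_rightC mulrC -mulrA mulrCA.
Qed.

Lemma lr_mul_nil3 u v w z : lr_mul u (lr_mul v (lr_mul w z)) = 0.
Proof.
rewrite {1}/lr_mul A_lr_mul mulmx0 linear0 linear0l B_lr_mul A_lr_mul mulmx0.
by rewrite !linear0 linear0r !addr0.
Qed.

HB.instance Definition _ :=
  bilinear_isBilinear.Build k g g g *:%R *:%R lr_mul lr_mul_bilinear.

Lemma lr_mul_is_LR : is_LR_structure lr_mul.
Proof.
split; [exact: lr_mul_leftC|exact: lr_mul_rightC|exact: lr_mul_lie].
Qed.

Lemma lr_mul_complete : is_complete lr_mul.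
Proof. by move=> u; exists 3 => v; apply: lr_mul_nil3. Qed.

End LRProduct.

Theorem proposition4p4 (k : fieldType) (hk : [pchar k] =i pred0) (n : nat)
    (g : lieAlgType k) (x : 'I_n -> g) (hg : is_free_nilpotent 3 x) :
  exists mul : {bilinear g -> g -> g}, is_LR_structure mul /\ is_complete mul.
Proof.
have [A [B [A_lie B_lie A_x B_x]]] := free_3_nilpotent_coordinates hg.
exists (lr_mul x A B); split; last exact: lr_mul_complete.
exact: lr_mul_is_LR.
Qed.
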